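(* Let $X$ be a Banach lattice and let $(E_n)_{n\ge 1}$ be a contractive filtration on $X$. Then the collection $M_X=M_X(X,(E_n))$ of all bounded $X$-martingales with respect to $(E_n)$ is a closed linear subspace of $\ell_\infty(X)$; hence $M_X$ is a Banach space under the supremum norm.
   Context: A contractive filtration on a normed lattice $X$ is a sequence $(E_n)_{n\ge1}$ of positive linear projections on $X$ (i.e. $E_n^2=E_n$ and $E_nx\ge 0$ whenever $x\ge 0$) which are contractive ($\|E_nx\|\le\|x\|$ for all $x\in X$) and satisfy $E_nE_m=E_{\min(n,m)}$ for all $n,m$. A sequence $(x_n)_{n\ge1}$ in $X$ is an $X$-martingale with respect to $(E_n)$ if $\lim_{n\to\infty}\sup_{m\ge n}\|E_nx_m-x_n\|=0$. A sequence $A=(x_n)$ is bounded if $\|A\|:=\sup_n\|x_n\|<\infty$. $\ell_\infty(X)$ denotes the space of all bounded sequences in $X$ with norm $\|A\|=\sup_n\|x_n\|$ and coordinate-wise linear operations. *)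

(* Defs.v *)
From HB Require Import structures.
From mathcomp Require Import all_boot all_order all_algebra.
From mathcomp Require Import all_classical all_reals all_analysis.
Set Implicit Arguments.
Unset Strict Implicit.
Unset Printing Implicit Defensive.
Import Order.TTheory GRing.Theory Num.Theory.
Import numFieldNormedType.Exports.
Local Open Scope classical_set_scope.
Local Open Scope ring_scope.

(* The order is a field of the structure instead of being inherited from
   Order.Lattice: numDomainType already joins orders with norms, and the
   hierarchy admits no second, incomparable join of the two. *)
HB.mixin Record Lmodule_isVectorLattice (R : realType) X
    of GRing.Lmodule R X := {
  vle : rel X ;
  vjoin : X -> X -> X ;
  vmeet : X -> X -> X ;
  vle_refl : reflexive vle ;
  vle_anti : antisymmetric vle ;
  vle_trans : transitive vle ;
  vjoin_le : forall x y z : X, vle (vjoin x y) z = vle x z && vle y z ;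
  le_vmeet : forall x y z : X, vle z (vmeet x y) = vle z x && vle z y ;
  vle_addr : forall z x y : X, vle x y -> vle (x + z) (y + z) ;
  vle_scale : forall (a : R) (x : X), 0 <= a -> vle 0 x -> vle 0 (a *: x)
}.

#[short(type="vectorLatticeType")]
HB.structure Definition VectorLattice (R : realType) :=
  {X of Lmodule_isVectorLattice R X & GRing.Lmodule R X}.

Definition vabs (R : realType) (X : vectorLatticeType R) (x : X) : X :=
  vjoin x (- x).

HB.mixin Record NormedModule_isNormedLattice (R : realType) X
    of NormedModule R X & VectorLattice R X := {
  ler_norm_vabs : forall x y : X, vle (vabs x) (vabs y) -> `|x| <= `|y|
}.

#[short(type="normedLatticeType")]
HB.structure Definition NormedLattice (R : realType) :=
  {X of NormedModule_isNormedLattice R X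
      & NormedModule R X & VectorLattice R X}.

#[short(type="banachLatticeType")]
HB.structure Definition BanachLattice (R : realType) :=
  {X of NormedLattice R X & CompleteNormedModule R X}.

Section submodule.
Context (R : realType) (V : lmodType R) (S : set V).
Context (submodS : submod_closed (mem S)).

Definition submodule_pred of submod_closed (mem S) : {pred V} := mem S.

HB.instance Definition _ :=
  GRing.isSubmodClosed.Build R V (submodule_pred submodS) submodS.

Record submodule := Submodule {
  submodule_val :> V ; submodule_valP : submodule_val \in submodule_pred submodS }.

HB.instance Definition _ := [isSub for submodule_val].
HB.instance Definition _ := [Choice of submodule by <:].
HB.instance Definition _ := [SubChoice_isSubLmodule of submodule by <:].
End submodule.

Section submodule_norm.
Context (R : realType) (V : normedModType R) (S : set V).
Context (submodS : submod_closed (mem S)).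
Let norm (x : submodule submodS) : R := `|submodule_val x|.

Let norm_triangle (x y : submodule submodS) : norm (x + y) <= norm x + norm y.
Proof. exact: ler_normD. Qed.

Let normZ (a : R) (x : submodule submodS) : norm (a *: x) = `|a| * norm x.
Proof. exact: normrZ. Qed.

Let norm_eq0 (x : submodule submodS) : norm x = 0 -> x = 0.
Proof. by move=> /normr0_eq0 x0; apply: val_inj. Qed.

HB.instance Definition _ := Lmodule_isNormed.Build R (submodule submodS)
  norm_triangle normZ norm_eq0.
End submodule_norm.

Definition banach_space (R : realType) (V : normedModType R) : Prop :=
  forall F : set_system V, ProperFilter F -> cauchy F -> cvg F.

Section linfty.
Context (R : realType) (X : normedModType R).

Definition bounded_seqs : set (nat -> X) := bounded_fun.

Fact bounded_seqsP u :
  bounded_seqs u <-> exists M, forall n, `|u n| <= M.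
Proof.
have FF : ProperFilter (globally [set: nat]) :=
  globally_properfilter (I : setT 0%N).
rewrite /bounded_seqs /= ex_bound; split=> -[M uM]; exists M.
  by move=> n; exact: uM.
by move=> n _; exact: uM.
Qed.

Fact bounded_seqs_submod : submod_closed (mem bounded_seqs).
Proof.
split; first by rewrite inE; apply/bounded_seqsP;
  exists 0 => n; rewrite normr0.
move=> a u v; rewrite !inE => /bounded_seqsP[M uM] /bounded_seqsP[N vN].
apply/bounded_seqsP; exists (`|a| * M + N) => n.
rewrite (le_trans (ler_normD _ _))// lerD//.
by rewrite normrZ ler_wpM2l// uM.
Qed.

Definition linfty := submodule bounded_seqs_submod.
HB.instance Definition _ := GRing.Lmodule.on linfty.

Implicit Types A : linfty.
Definition linfty_seq A : nat -> X := submodule_val A.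

Definition linfty_norm A : R := sup [set `|linfty_seq A n| | n in setT].

Fact linfty_norm_ub A n : `|linfty_seq A n| <= linfty_norm A.
Proof.
apply: ub_le_sup; last by exists n.
case: A => u uP /=; move: (uP); rewrite inE => /bounded_seqsP[M uM].
by exists M => _ [m _ <-]; exact: uM.
Qed.

Fact linfty_norm_le A M : (forall n, `|linfty_seq A n| <= M) ->
  linfty_norm A <= M.
Proof.
by move=> AM; apply: ge_sup => [|_ [n _ <-]//]; exists `|linfty_seq A 0|, 0.
Qed.

Let norm_triangle A B : linfty_norm (A + B) <= linfty_norm A + linfty_norm B.
Proof.
apply: linfty_norm_le => n; rewrite (le_trans (ler_normD _ _))//.
by rewrite lerD//; exact: linfty_norm_ub.
Qed.

Let normZ_le a A : linfty_norm (a *: A) <= `|a| * linfty_norm A.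
Proof.
apply: linfty_norm_le => n; rewrite normrZ ler_wpM2l//; exact: linfty_norm_ub.
Qed.

Let normZ a A : linfty_norm (a *: A) = `|a| * linfty_norm A.
Proof.
apply/eqP; rewrite eq_le normZ_le/=.
have [->|a0] := eqVneq a 0.
  by rewrite normr0 mul0r (le_trans _ (linfty_norm_ub _ 0%N)).
rewrite -{1}[A](scalerK a0) -ler_pdivlMl ?normr_gt0// -normfV.
exact: normZ_le.
Qed.

Let norm_eq0 A : linfty_norm A = 0 -> A = 0.
Proof.
move=> A0; apply/val_inj/funext => n; apply/normr0_eq0/eqP.
by rewrite eq_le normr_ge0 andbT -A0 linfty_norm_ub.
Qed.

HB.instance Definition _ := Lmodule_isNormed.Build R linfty
  norm_triangle normZ norm_eq0.
End linfty.

(* Indices start at 0: E n and x n stand for the operator and the term of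
   index n + 1 in the usual numbering; minn is invariant under this shift. *)
Record contractive_filtration (R : realType) (X : normedLatticeType R)
    (E : nat -> {linear X -> X}) : Prop := {
  filtration_proj : forall n x, E n (E n x) = E n x ;
  filtration_pos : forall n x, vle 0 x -> vle 0 (E n x) ;
  filtration_contr : forall n x, `|E n x| <= `|x| ;
  filtration_min : forall n m x, E n (E m x) = E (minn n m) x
}.

(* The supremum is extended-real because it may be infinite for small n. *)
Definition is_martingale (R : realType) (X : normedLatticeType R)
    (E : nat -> {linear X -> X}) (x : nat -> X) : Prop :=
  ereal_sup [set (`|E n (x m) - x n|)%:E | m in [set m | (n <= m)%N]]
    @[n --> \oo] --> 0%E.

Definition M_X (R : realType) (X : normedLatticeType R)
    (E : nat -> {linear X -> X}) : set (linfty X) :=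
  [set A | is_martingale E (linfty_seq A)].

(* Main.v *)
Require Import Defs.
From HB Require Import structures.
From mathcomp Require Import all_boot all_order all_algebra.
From mathcomp Require Import all_classical all_reals all_analysis.
From mathcomp Require Import ring.
Import Order.TTheory GRing.Theory Num.Theory numFieldNormedType.Exports.
Local Open Scope classical_set_scope.
Local Open Scope ring_scope.

(** Completeness of [X] gives completeness of [linfty X] ([linfty_complete]): a Cauchy filter
    converges in each coordinate, and its estimates, being uniform in the coordinate, survive in the
    limit. Inside [linfty X], linearity of [E n] makes the martingales a subspace ([M_X_submod]),
    and contractivity makes a uniform limit of martingales a martingale by an e/3 argument
    ([M_X_closed]). A closed subspace of a complete space is complete
    ([closed_submodule_complete]). *)

Lemma linfty_norm_seq {R : realType} {X : normedModType R} (A : linfty X)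
    (n : nat) : `|linfty_seq A n| <= `|A|.
Proof. exact: linfty_norm_ub. Qed.

Lemma linfty_complete (R : realType) (X : completeNormedModType R) :
  banach_space (linfty X).
Proof.
move=> F FF /cauchyP Fcauchy.
have coordF n : linfty_seq A n @[A --> F] --> lim (linfty_seq A n @[A --> F]).
  apply: cauchy_cvg; apply: cauchy_exP => e e0.
  have [A FA] := Fcauchy e e0; exists (linfty_seq A n).
  rewrite /nbhs/=; apply: filterS FA => B; rewrite -!ball_normE/= => AB.
  exact: le_lt_trans (linfty_norm_seq (A - B) n) AB.
pose u n := lim (linfty_seq A n @[A --> F]).
(* This is where the estimate becomes uniform: [B] is chosen for one [n] and slack [d], but the
   resulting bound [e] depends on neither. *)
have ball_lim A e : F (ball A e) -> forall n, `|linfty_seq A n - u n| <= e.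
  move=> FA n; apply/ler_addgt0Pr => d d0.
  have Fd : \forall B \near F, `|u n - linfty_seq B n| <= d.
    by move/cvgrPdist_le: (coordF n); exact.
  have [B [/= AB Bd]] := filter_ex (filterI FA Fd).
  rewrite (le_trans (ler_distD (linfty_seq B n) _ _))// lerD//.
    move: AB; rewrite -ball_normE/= => /ltW; apply: le_trans.
    exact: (linfty_norm_seq (A - B)).
  by rewrite distrC.
have u_bounded : bounded_seqs u.
  have [A FA] := Fcauchy 1 ltr01.
  apply/bounded_seqsP; exists (`|A| + 1) => n.
  rewrite -(subKr (linfty_seq A n) (u n)) (le_trans (ler_normB _ _))//.
  by rewrite lerD// ?linfty_norm_seq// ball_lim.
have uS : u \in submodule_pred (bounded_seqs_submod X).
  by rewrite /submodule_pred inE.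
pose U : linfty X := Submodule uS.
apply/cvg_ex; exists U; apply/cvgrPdist_le => e e0.
(* The centre [A] is a pivot: within e/2 of [U] by [ball_lim], and of each [B] in the ball. *)
have [A FA] := Fcauchy (e / 2) (divr_gt0 e0 (ltr0n _ 2)).
apply: filterS (FA) => B; rewrite -ball_normE/= => /ltW AB.
rewrite (le_trans (ler_distD A _ _))// (splitr e) lerD//.
rewrite distrC; apply: linfty_norm_le => n; exact: ball_lim FA n.
Qed.

(** The inclusion is isometric, so a Cauchy filter can be pushed to [V]; closedness keeps the limit
    in [S], and convergence pulls back. *)
Lemma closed_submodule_complete (R : realType) (V : normedModType R)
    (S : set V) (submodS : submod_closed (mem S)) :
  closed S -> banach_space V -> banach_space (submodule submodS).
Proof.
move=> Sclosed Vcomplete F FF /cauchyP Fcauchy.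
pose G := submodule_val x @[x --> F].
have /cvg_ex[v Gv] : cvg G.
  apply: Vcomplete; apply: cauchy_exP => e e0.
  have [x Fx] := Fcauchy e e0; exists (submodule_val x).
  by rewrite /G/= /nbhs/=; apply: filterS Fx => y; rewrite -!ball_normE.
have Sv : v \in submodule_pred submodS.
  rewrite /submodule_pred inE; apply: closed_cvg Gv => //.
  by apply: nearW => x; have := submodule_valP x; rewrite /submodule_pred inE.
apply/cvg_ex; exists (Submodule Sv); apply/cvgrPdist_le => e e0.
by move/cvgrPdist_le: Gv => /(_ e e0).
Qed.

Lemma is_martingaleP (R : realType) (X : normedLatticeType R)
    (E : nat -> {linear X -> X}) (x : nat -> X) :
  is_martingale E x <-> forall e, 0 < e ->
    \forall n \near \oo, forall m, (n <= m)%N -> `|E n (x m) - x n| <= e.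
Proof.
(* [fine] sends infinite values to 0, so eventual finiteness must accompany convergence of the real
   parts. *)
rewrite /is_martingale; split=> [/fine_cvgP[fin_sup sup0] e e0|sup0].
  move/cvgrPdist_le: sup0 => /(_ e e0).
  apply: filterS2 fin_sup => n /= fn.
  rewrite sub0r normrN => /(le_trans (ler_norm _)) sup_le m nm.
  rewrite -lee_fin (@le_trans _ _ (ereal_sup
    [set (`|E n (x m) - x n|)%:E | m in [set m | (n <= m)%N]]))//.
    by apply: ereal_sup_ubound; exists m.
  by rewrite -(fineK fn) lee_fin.
(* The index m = n is always admissible, so the supremum is never -oo; any finite upper bound then
   makes it finite. *)
have sup_ge0 n : (0 <= ereal_sup
    [set (`|E n (x m) - x n|)%:E | m in [set m | (n <= m)%N]])%E.
  apply: (@le_trans _ _ (`|E n (x n) - x n|)%:E); first by rewrite lee_fin.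
  by apply: ereal_sup_ubound; exists n => //=.
have sup_le e : 0 < e -> \forall n \near \oo, (ereal_sup
    [set (`|E n (x m) - x n|)%:E | m in [set m | (n <= m)%N]] <= e%:E)%E.
  move=> /sup0; apply: filterS => n xn.
  by apply: ge_ereal_sup => _ [m nm <-]; rewrite lee_fin xn.
apply/fine_cvgP; split.
  apply: filterS (sup_le 1 ltr01) => n n1.
  by rewrite ge0_fin_numE// (le_lt_trans n1)// ltry.
apply/cvgrPdist_le => e e0; apply: filterS (sup_le e e0) => n ne /=.
rewrite sub0r normrN ger0_norm ?fine_ge0//.
by rewrite -lee_fin fineK// ge0_fin_numE// (le_lt_trans ne)// ltry.
Qed.

Lemma M_X_submod (R : realType) (X : normedLatticeType R)
    (E : nat -> {linear X -> X}) : submod_closed (mem (M_X E)).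
Proof.
split=> [|a A B].
  rewrite inE; apply/is_martingaleP => e e0; apply: nearW => n m _.
  by rewrite /linfty_seq/= linear0 subrr normr0 ltW.
rewrite !inE => /is_martingaleP MA /is_martingaleP MB.
apply/is_martingaleP => e e0.
(* Dividing by [|a| + 1] instead of [|a|] covers a = 0. *)
have a1 : 0 < `|a| + 1 by rewrite ltr_wpDl.
have := MB (e / 2) (divr_gt0 e0 (ltr0n _ 2)).
have := MA (e / 2 / (`|a| + 1)) (divr_gt0 (divr_gt0 e0 (ltr0n _ 2)) a1).
apply: filterS2 => n An Bn m nm.
rewrite /linfty_seq/= linearP opprD addrACA -scalerBr.
rewrite (le_trans (ler_normD _ _))// (splitr e) lerD ?Bn// normrZ.
rewrite -[leRHS](mulfVK (lt0r_neq0 a1)) mulrC ler_pM ?An//.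
by rewrite lerDl.
Qed.

(* Contractivity of E_n makes the martingale defect |E_n x_m - x_n|
   2-Lipschitz in the sup norm, uniformly in n and m. *)
Lemma M_X_closed (R : realType) (X : normedLatticeType R)
    (E : nat -> {linear X -> X}) :
  (forall n x, `|E n x| <= `|x|) -> closed (M_X E).
Proof.
move=> contrE A clA; apply/is_martingaleP => e e0.
have e3 : 0 < e / 3 by rewrite divr_gt0.
have [B [/is_martingaleP MB]] := clA _ (nbhsx_ballx A _ e3).
rewrite -ball_normE/= => /ltW AB.
have ABn n : `|linfty_seq A n - linfty_seq B n| <= e / 3.
  exact: le_trans (linfty_norm_seq (A - B) n) AB.
apply: filterS (MB _ e3) => n Bn m nm.
(* The thirds bound E_n(A_m - B_m), the defect of [B], and B_n - A_n. *)
have -> : e = e / 3 + (e / 3 + e / 3) by field.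
rewrite (le_trans (ler_distD (E n (linfty_seq B m)) _ _))// lerD//.
  by rewrite -linearB (le_trans (contrE _ _)).
rewrite (le_trans (ler_distD (linfty_seq B n) _ _))// lerD ?Bn//.
by rewrite distrC.
Qed.

Theorem theorem3 (R : realType) (X : banachLatticeType R)
    (E : nat -> {linear X -> X}) (hE : contractive_filtration E) :
  exists submodM : submod_closed (mem (M_X E)),
    closed (M_X E) /\ banach_space (submodule submodM).
Proof.
have closedM : closed (M_X E) := M_X_closed R X E (filtration_contr hE).
exists (M_X_submod R X E); split=> //.
apply: closed_submodule_complete => //; exact: linfty_complete.
Qed.
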